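(* Let $A$ be an $m$-by-$n$ $(0,1,\ast)$-matrix. A set $L\subseteq\{0,1\}^n$ is a solution for $A$ if and only if $(L+L)\cap K_A=\emptyset$, where $L+L=\{\mathbf{x}\oplus\mathbf{y}:\mathbf{x},\mathbf{y}\in L\}$.
   Context: A $(0,1,\ast)$-matrix is a matrix with entries in $\{0,1,\ast\}$; all arithmetic is over $GF_2$. A completion of $A$ is a $(0,1)$-matrix obtained from $A$ by replacing each $\ast$ by $0$ or $1$. For $A=(a_{ij})$, an operator $G=(g_1,\dots,g_m):\{0,1\}^n\to\{0,1\}^m$ is consistent with $A$ if each $g_i$ depends only on the variables $x_j$ with $a_{ij}=\ast$. A set $L\subseteq\{0,1\}^n$ is a solution for $A$ if there exist a completion $M$ of $A$ and an operator $G$ consistent with $A$ such that $M\mathbf{x}=G(\mathbf{x})$ for all $\mathbf{x}\in L$. For $i\in[m]$, let $\mathbf{a}_i$ be the $i$th row of $A$ with all stars set to $0$, and let $D_i$ be the diagonal $n$-by-$n$ $(0,1)$-matrix whose $j$th diagonal entry is $1$ iff $a_{ij}=\ast$. The set of forbidden vectors is $K_A=\{\mathbf{x}\in\{0,1\}^n: \exists i\in[m]\ D_i\mathbf{x}=\mathbf{0}\text{ and }\langle\mathbf{a}_i,\mathbf{x}\rangle=1\}$, where $\langle\cdot,\cdot\rangle$ is the scalar product over $GF_2$. *)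

(* Defs.v *)
From mathcomp Require Import all_boot all_algebra.
Set Implicit Arguments.
Unset Strict Implicit.
Unset Printing Implicit Defensive.
Import GRing.Theory.
Local Open Scope ring_scope.

(* [Some b] is the entry b in {0,1}, [None] is a star. *)
Definition entry : Type := option 'F_2.
Definition star : entry := None.

Definition completion m n (A : 'M[entry]_(m, n)) (M : 'M['F_2]_(m, n)) : Prop :=
  forall (i : 'I_m) (j : 'I_n) (b : 'F_2), A i j = Some b -> M i j = b.

Definition consistent m n (A : 'M[entry]_(m, n))
    (G : 'cV['F_2]_n -> 'cV['F_2]_m) : Prop :=
  forall (i : 'I_m) (x y : 'cV['F_2]_n),
    (forall j : 'I_n, A i j = star -> x j 0 = y j 0) -> G x i 0 = G y i 0.

Definition solution m n (A : 'M[entry]_(m, n)) (L : {set 'cV['F_2]_n}) : Prop :=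
  exists (M : 'M['F_2]_(m, n)) (G : 'cV['F_2]_n -> 'cV['F_2]_m),
    [/\ completion A M, consistent A G & forall x, x \in L -> M *m x = G x].

Definition row_star0 m n (A : 'M[entry]_(m, n)) (i : 'I_m) : 'cV['F_2]_n :=
  \col_j odflt 0 (A i j).

Definition star_diag m n (A : 'M[entry]_(m, n)) (i : 'I_m) : 'M['F_2]_n :=
  diag_mx (\row_j (if A i j is None then 1 else 0)).

Definition dotp n (u v : 'cV['F_2]_n) : 'F_2 := \sum_j u j 0 * v j 0.

Definition forbidden m n (A : 'M[entry]_(m, n)) : {set 'cV['F_2]_n} :=
  [set x : 'cV['F_2]_n | [exists i : 'I_m,
     (star_diag A i *m x == 0) && (dotp (row_star0 A i) x == 1)]].

Definition sumset n (L : {set 'cV['F_2]_n}) : {set 'cV['F_2]_n} :=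
  [set x + y | x in L, y in L].

(* Main.v *)
(** Two vectors x, y agree on the stars of row i exactly when D_i (x + y) = 0.
    If L is a solution, then G forces row i of M to take the same value on any
    two such x, y in L, so that <a_i, x + y> = 0 and x + y is not forbidden.
    Conversely, if no sum is forbidden, then the value <a_i, x> for x in L
    depends only on the starred coordinates of x, so setting all stars to 0
    gives a completion M, and g_i is read off any element of L with the given
    starred coordinates. *)
Require Import Defs.
From mathcomp Require Import all_boot all_algebra.
Set Implicit Arguments.
Unset Strict Implicit.
Unset Printing Implicit Defensive.
Import GRing.Theory.
Local Open Scope ring_scope.

Lemma F2_addr_eq0 (a b : 'F_2) : (a + b == 0) = (a == b).
Proof. by rewrite -[RHS]subr_eq0 (oppr_pchar2 (pchar_Fp _)). Qed.

Lemma F2_neq0 (a : 'F_2) : (a != 0) = (a == 1).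
Proof. by case: a => [[|[|k]] lt_k]. Qed.

Lemma dotpDr n (u v w : 'cV['F_2]_n) : dotp u (v + w) = dotp u v + dotp u w.
Proof.
by rewrite /dotp -big_split /=; apply: eq_bigr => j _; rewrite mxE mulrDr.
Qed.

Section StarMatrix.

Variables (m n : nat) (A : 'M[entry]_(m, n)).
Implicit Types (i : 'I_m) (x y z : 'cV['F_2]_n) (L : {set 'cV['F_2]_n}).

Definition star_agree i x y :=
  [forall j, ~~ isSome (A i j) ==> (x j 0 == y j 0)].

Lemma star_agreeP i x y :
  reflect (forall j, A i j = star -> x j 0 = y j 0) (star_agree i x y).
Proof.
apply: (iffP forallP) => [xy j Aij | xy j].
  by have := xy j; rewrite Aij => /eqP.
by case Aij: (A i j) => //=; apply/eqP/xy.
Qed.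

Lemma star_diagD_eq0 i x y :
  (star_diag A i *m (x + y) == 0) = star_agree i x y.
Proof.
have E j : (star_diag A i *m (x + y)) j 0 =
           (if A i j is None then 1 else 0) * (x j 0 + y j 0).
  by rewrite mul_diag_mx !mxE.
apply/eqP/star_agreeP => [Dxy j Aij | xy].
  have /eqP := E j.
  by rewrite Dxy Aij mxE mul1r eq_sym F2_addr_eq0 => /eqP.
apply/matrixP => j k; rewrite (ord1 k) E mxE.
case Aij: (A i j) => [b|]; first by rewrite mul0r.
by rewrite mul1r; apply/eqP; rewrite F2_addr_eq0 xy.
Qed.

(** In characteristic 2 a sum vanishes iff its two terms are equal, and a nonzero value is 1. So row
    [i] forbids [x + y] exactly when [x] and [y] agree on its stars but have different products with
    [row_star0 A i]. *)
Lemma sumset_forbidden_eq0P L :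
  sumset L :&: forbidden A = set0 <->
  {in L &, forall x y i, star_agree i x y ->
     dotp (row_star0 A i) x = dotp (row_star0 A i) y}.
Proof.
split=> [LK0 x y Lx Ly i xy | eqL].
  apply/eqP; rewrite -F2_addr_eq0 -dotpDr; apply/negPn; rewrite F2_neq0.
  apply/negP => xy1.
  have /setP/(_ (x + y)) := LK0; rewrite !inE imset2_f //=.
  by move/existsP; case; exists i; rewrite star_diagD_eq0 xy.
apply/setP => z; rewrite !inE; apply/negP.
case/andP=> /imset2P[x y Lx Ly ->] /existsP[i].
rewrite star_diagD_eq0 dotpDr -F2_neq0 F2_addr_eq0 => /andP[xy].
by rewrite (eqL x y) // eqxx.
Qed.

(** The values that [M] puts at the stars of row [i] are arbitrary, but they multiply coordinates
    where [x + y] is 0. *)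
Lemma completion_star_agree M i x y : completion A M -> star_agree i x y ->
  (M *m x) i 0 + (M *m y) i 0 =
  dotp (row_star0 A i) x + dotp (row_star0 A i) y.
Proof.
move=> complM /star_agreeP xy; rewrite -dotpDr.
transitivity ((M *m (x + y)) i 0); first by rewrite mulmxDr [RHS]mxE.
rewrite mxE; apply: eq_bigr => j _; rewrite !mxE.
case Aij: (A i j) => [b|]; first by rewrite (complM _ _ _ Aij).
have /eqP-> : x j 0 + y j 0 == 0 by rewrite F2_addr_eq0 xy.
by rewrite !mulr0.
Qed.

Definition zero_completion : 'M['F_2]_(m, n) := \matrix_i (row_star0 A i)^T.

Lemma zero_completionP : completion A zero_completion.
Proof. by move=> i j b Aij; rewrite !mxE Aij. Qed.

Lemma zero_completion_mulE x i :
  (zero_completion *m x) i 0 = dotp (row_star0 A i) x.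
Proof. by rewrite mxE; apply: eq_bigr => j _; rewrite !mxE. Qed.

Definition solution_operator L x : 'cV['F_2]_m :=
  \col_i (if [pick y in L | star_agree i x y] is Some y
          then dotp (row_star0 A i) y else 0).

Lemma solution_operator_consistent L : consistent A (solution_operator L).
Proof.
move=> i x y xy; rewrite !mxE.
(* [pick] chooses by the extension of its predicate alone, and this is the same for [x] and [y]. *)
rewrite (eq_pick (Q := fun z => (z \in L) && star_agree i y z)) // => z /=.
congr (_ && _); apply/star_agreeP/star_agreeP => H j Aij.
  by rewrite -xy ?H.
by rewrite xy ?H.
Qed.

End StarMatrix.

Theorem theorem3 (m n : nat) (A : 'M[entry]_(m, n)) (L : {set 'cV['F_2]_n}) :
  solution A L <-> sumset L :&: forbidden A = set0.
Proof.
split=> [[M [G [complM consG MG]]] | /sumset_forbidden_eq0P eqL].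
  apply/sumset_forbidden_eq0P => x y Lx Ly i xy.
  apply/eqP; rewrite -F2_addr_eq0.
  rewrite -(completion_star_agree complM xy) !MG // F2_addr_eq0.
  by apply/eqP/consG/star_agreeP.
exists (zero_completion A), (solution_operator A L); split=> [||x Lx].
- exact: zero_completionP.
- exact: solution_operator_consistent.
apply/matrixP => i k; rewrite (ord1 k) zero_completion_mulE mxE.
case: pickP => [y /andP[Ly xy] | /(_ x)]; first exact: eqL.
(* The default 0 is never reached on [L], since [x] is itself a candidate. *)
by rewrite Lx /= => /negP[]; apply/star_agreeP.
Qed.
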